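(* Let $R$ be a semiprimitive commutative ring with identity. Then $\mathrm{Max}(R)$ is a cofinite space if and only if for every infinite subset $\mathcal{F}$ of $\mathrm{Max}(R)$ we have $\bigcap_{M\in\mathcal{F}}M=\{0\}$.
   Context: $\mathrm{Max}(R)$ is the set of maximal ideals of $R$ with the Zariski (hull-kernel) topology, whose closed sets are the sets $\{M\in\mathrm{Max}(R): S\subseteq M\}$ for $S\subseteq R$. $R$ is semiprimitive if the intersection of all its maximal ideals is $\{0\}$. A topological space $X$ is a cofinite space if its topology is $\{G\subseteq X: X\setminus G\text{ is finite}\}\cup\{\emptyset\}$. *)

(* Defs.v *)
From HB Require Import structures.
From mathcomp Require Import all_boot all_algebra.
From mathcomp Require Import all_classical topology.

Set Implicit Arguments.
Unset Strict Implicit.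
Unset Printing Implicit Defensive.

Import GRing.Theory.

Local Open Scope classical_set_scope.
Local Open Scope ring_scope.

(* [idealr_closed] from ring_quotient.v is not used: it has properness built
   in and needs an [nzRingType], whereas the zero ring is allowed here.
   Closure under opposite is the case [a = -1] of the last clause. *)
Definition ideal (R : comPzRingType) (I : set R) : Prop :=
  [/\ I 0,
      (forall x y, I x -> I y -> I (x + y)) &
      (forall a x, I x -> I (a * x))].

Definition maximal_ideal (R : comPzRingType) (M : set R) : Prop :=
  [/\ ideal M,
      M <> setT &
      forall J : set R, ideal J -> M `<=` J -> J <> setT -> J = M].

Record Max (R : comPzRingType) := MaxIdeal {
  max_carrier :> set R;
  maxP : maximal_ideal max_carrier
}.

HB.instance Definition _ (R : comPzRingType) := gen_eqMixin (Max R).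
HB.instance Definition _ (R : comPzRingType) := gen_choiceMixin (Max R).

Lemma Max_inj (R : comPzRingType) (M N : Max R) :
  (M : set R) = (N : set R) -> M = N.
Proof.
case: M N => [M hM] [N hN] /= eMN; subst N.
by rewrite (Prop_irrelevance hM hN).
Qed.

Lemma max_prime (R : comPzRingType) (M : Max R) (a b : R) :
  (M : set R) (a * b) -> (M : set R) a \/ (M : set R) b.
Proof.
case: (maxP M) => -[M0 MD MM] _ Mmax Mab.
have [Ma|nMa] := pselect ((M : set R) a); [by left | right].
pose J : set R := [set x | exists m r, (M : set R) m /\ x = m + r * a].
have idJ : ideal J.
  split.
  - by exists 0, 0; rewrite mul0r addr0.
  - move=> _ _ [m [r [Mm ->]]] [n [s [Mn ->]]].
    by exists (m + n), (r + s); rewrite mulrDl addrACA; split => //; apply: MD.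
  - move=> c _ [m [r [Mm ->]]].
    by exists (c * m), (c * r); rewrite mulrDr mulrA; split => //; apply: MM.
have sMJ : M `<=` J by move=> x Mx; exists x, 0; rewrite mul0r addr0.
have [JT|nJT] := pselect (J = setT).
  have [m [r [Mm e1]]] : J 1 by rewrite JT.
  rewrite -[b]mul1r e1 mulrDl -mulrA; apply: MD; last exact: MM.
  by rewrite mulrC; apply: MM.
case: nMa; rewrite -(Mmax J idJ sMJ nJT).
by exists 0, 1; rewrite mul1r add0r.
Qed.

Definition hull (R : comPzRingType) (S : set R) : set (Max R) :=
  [set M : Max R | S `<=` (M : set R)].

Definition zariski_open (R : comPzRingType) : set_system (Max R) :=
  [set U | exists S : set R, ~` U = hull S].

Section ZariskiTopology.
Variable R : comPzRingType.

Let zariski_openT : @zariski_open R setT.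
Proof.
exists setT; rewrite setCT; apply/esym/seteqP; split => // M /= sTM.
by case: (maxP M) => _ + _; apply; apply/seteqP; split.
Qed.

Let zariski_openI : setI_closed (@zariski_open R).
Proof.
move=> U V [S eS] [T eT].
exists [set x | exists s t, [/\ S s, T t & x = s * t]].
rewrite setCI eS eT; apply/seteqP; split => M.
  case: (maxP M) => -[_ _ MM] _ _.
  case=> /= hM _ [s [t [Ss Tt ->]]]; last exact/MM/hM.
  by rewrite mulrC; apply/MM/hM.
move=> /= hST; have [hS|nS] := pselect (S `<=` (M : set R)); [by left | right].
move=> t Tt; apply: contrapT => nMt; apply: nS => s Ss.
by have [] := max_prime (hST _ (ex_intro _ s (ex_intro _ t (And3 Ss Tt erefl)))).
Qed.

Let zariski_open_bigU (I : Type) (f : I -> set (Max R)) :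
  (forall i, zariski_open (f i)) -> zariski_open (\bigcup_i f i).
Proof.
move=> /choice[S eS]; exists (\bigcup_i S i); rewrite setC_bigcup.
apply/seteqP; split => M /= h.
  by move=> x [i _ Sx]; have := h i Logic.I; rewrite eS; apply.
by move=> i _; rewrite eS => x Sx; apply: h; exists i.
Qed.

HB.instance Definition _ := isOpenTopological.Build (Max R)
  zariski_openT zariski_openI zariski_open_bigU.

End ZariskiTopology.

Lemma zariski_closedP (R : comPzRingType) (C : set (Max R)) :
  closed C <-> exists S : set R, C = hull S.
Proof. by rewrite -openC; split => -[S eS]; exists S; move: eS; rewrite setCK. Qed.

Definition semiprimitive (R : comPzRingType) : Prop :=
  \bigcap_(M in [set: Max R]) (M : set R) = [set 0].

Definition cofinite_space (X : topologicalType) : Prop :=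
  [set G : set X | open G] = [set G | cofinite_set G] `|` [set set0].

(* Main.v *)
Require Import Defs.
From mathcomp Require Import all_boot all_algebra.
From mathcomp Require Import all_classical topology.

Local Open Scope classical_set_scope.
Local Open Scope ring_scope.

(** The closed sets of [Max R] are the hulls [hull S], and semiprimitivity
    says exactly that an element whose hull is the whole space vanishes.

    If [Max R] is cofinite and [x] lies in all members of an infinite family,
    then [hull [set x]] is an infinite closed set, hence everything, so [x] is
    zero.  Conversely, if infinite families have zero intersection and [hull S]
    is infinite, then [S] contains at most [0] and [hull S] is everything; so
    every closed set is finite or full.  That finite sets are closed is the
    T1 property of [Max R], which comes from maximality. *)

(** Maximal ideals that are comparable are equal, so a point is its own hull. *)
Lemma hull_max (R : comPzRingType) (M : Max R) : hull (M : set R) = [set M].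
Proof.
apply/seteqP; split => [N /= sMN|_ -> //].
case: (maxP M) => _ _ Mmax; case: (maxP N) => idN NT _.
exact/Max_inj/Mmax.
Qed.

Lemma closed_finite_Max (R : comPzRingType) (F : set (Max R)) :
  finite_set F -> closed F.
Proof.
move=> finF.
have -> : F = \bigcup_(M in F) [set M] by rewrite bigcup_imset1 image_id.
apply: closed_bigcup => // M _.
by apply/zariski_closedP; exists (M : set R); rewrite hull_max.
Qed.

Lemma semiprimitive_hull1 (R : comPzRingType) (x : R) :
  semiprimitive R -> hull [set x] = setT -> x = 0.
Proof.
move=> hR hT; suff : [set 0] x by [].
rewrite -hR => M _.
have : hull [set x] M by rewrite hT.
exact.
Qed.

Lemma hull_sub0 (R : comPzRingType) (S : set R) :
  S `<=` [set 0] -> hull S = setT.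
Proof.
move=> S0; apply/seteqP; split => // M _ x /S0 ->.
by case: (maxP M) => -[].
Qed.

Theorem proposition4p10 (R : comPzRingType) (hR : semiprimitive R) :
  cofinite_space (Max R) <->
  forall F : set (Max R), infinite_set F ->
    \bigcap_(M in F) (M : set R) = [set 0].
Proof.
split=> [cofR F infF|inf0].
  apply/seteqP; split => [x Fx|_ -> M _]; last by case: (maxP M) => -[].
  apply: (@semiprimitive_hull1 _ _ hR).
  have sFx : F `<=` hull [set x] by move=> M FM _ ->; exact: Fx.
  have : [set G : set (Max R) | open G] (~` hull [set x]).
    by apply/closed_openC/zariski_closedP; exists [set x].
  (* The empty open set of the cofinite topology is the case of a full hull. *)
  rewrite cofR => -[|/= h0]; last by rewrite -[hull _]setCK h0 setC0.
  by rewrite /= setCK => /(sub_finite_set sFx).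
apply/seteqP; split => [U /= [S eS]|U /= [finU|->]].
- have [finU|infU] := pselect (finite_set (~` U)); [by left | right].
  have S0 : S `<=` [set 0].
    by rewrite -(inf0 _ infU) eS => x Sx M; apply.
  by rewrite -[U]setCK eS (hull_sub0 _ _ S0) setCT.
- by rewrite -[U]setCK; exact: closed_openC (closed_finite_Max _ _ finU).
- exact: open0.
Qed.
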